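(* Let $L\ge 1$ be an integer, $0<b<1$, $0<\Delta<1$, let $b_1,\dots,b_L\in\mathbb{C}$ be distinct with $|b_\ell|=b$ for all $\ell$, and let $C_1,\dots,C_L\in\mathbb{C}\setminus\{0\}$. Let $(\alpha_n)_{n\ge 0}$ be a sequence of Verblunsky coefficients with $$\alpha_n=\sum_{\ell=1}^L C_\ell b_\ell^n+O((b\Delta)^n)\qquad (n\to\infty).$$ Put $\omega_\ell=\bar b_\ell/b$. Suppose $n(1)<n(2)<\cdots$ is a sequence of positive integers such that $\omega_\ell^{(\infty)}:=\lim_{j\to\infty}\omega_\ell^{n(j)}$ exists for each $\ell=1,\dots,L$. Let $$P_\infty(z)=\sum_{\ell=1}^L \overline{C_\ell}\,\omega_\ell^{(\infty)}\prod_{k\ne\ell}(z-\bar b_k)$$ and let $w_1,\dots,w_J$ be the zeros of $P_\infty$ in $\{z : |z|<b\}$, listed with multiplicity. Then for every sufficiently small $\delta>0$ there is $N_\delta$ such that for all $j\ge N_\delta$, $\varphi_{n(j)}$ has one zero within $\delta$ of each $w_i$ (meaning: exactly $k$ zeros, counting multiplicity, within $\delta$ of a point that occurs exactly $k$ times in the list $w_1,\dots,w_J$), and no other zero in $\{z : |z|<b-\delta\}$.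
   Context: A sequence of Verblunsky coefficients is a sequence $(\alpha_n)_{n\ge0}$ in the open unit disk $\mathbb{D}$. The associated monic orthogonal polynomials on the unit circle are defined by $\Phi_0=1$ and $\Phi_{n+1}(z)=z\Phi_n(z)-\overline{\alpha_n}\,\Phi_n^*(z)$, where $\Phi_n^*(z)=z^n\,\overline{\Phi_n(1/\bar z)}$. The orthonormal polynomials are $\varphi_n=\Phi_n\big/\prod_{j=0}^{n-1}(1-|\alpha_j|^2)^{1/2}$. *)

(* Defs.v *)
From HB Require Import structures.
From mathcomp Require Import all_boot all_order all_algebra complex.
From mathcomp Require Import all_classical all_reals all_analysis.
Set Implicit Arguments.
Unset Strict Implicit.
Unset Printing Implicit Defensive.
Import Order.TTheory GRing.Theory Num.Theory.
Import numFieldNormedType.Exports.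
Local Open Scope ring_scope.

Section OPUC.
Variable C : numClosedFieldType.
Implicit Types (p : {poly C}) (z : C) (alpha : nat -> C).

(* The reversal z ^ n * conj (p (1 / conj z)) of a polynomial p of degree at
   most n, given by its coefficients; see rev_polyE. *)
Definition rev_poly (n : nat) p : {poly C} :=
  \poly_(i < n.+1) (p`_(n - i))^*.

Lemma rev_polyE n p z : (size p <= n.+1)%N -> z != 0 ->
  (rev_poly n p).[z] = z ^+ n * (p.[(z^*)^-1])^*.
Proof.
move=> sp z0; rewrite horner_poly (horner_coef_wide _ sp) rmorph_sum mulr_sumr.
rewrite (reindex_inj rev_ord_inj); apply: eq_bigr => i _ /=.
have le_in : (i <= n)%N by rewrite -ltnS.
rewrite subSS subKn // rmorphM rmorphXn fmorphV /= conjCK mulrCA; congr (_ * _).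
have -> : z ^+ n = z ^+ (n - i) * z ^+ i by rewrite -exprD subnK.
by rewrite exprVn mulfK // expf_neq0.
Qed.

Fixpoint Phi alpha (n : nat) : {poly C} :=
  if n is m.+1 then
    'X * Phi alpha m - (alpha m)^* *: rev_poly m (Phi alpha m)
  else 1.

Lemma size_Phi alpha n : size (Phi alpha n) = n.+1.
Proof.
elim: n => [|n IH] /=; first by rewrite size_poly1.
have nz : Phi alpha n != 0 by rewrite -size_poly_eq0 IH.
have sX : size ('X * Phi alpha n) = n.+2 by rewrite mulrC size_mulX // IH.
rewrite size_polyDl sX // size_polyN.
by apply: leq_ltn_trans (size_scale_leq _ _) _; rewrite ltnS size_poly.
Qed.

Definition phi alpha (n : nat) : {poly C} :=
  (\prod_(j < n) sqrtC (1 - `|alpha j| ^+ 2))^-1 *: Phi alpha n.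

(* The zeros of p, listed with multiplicity; meaningful for p != 0 only. *)
Definition zeroseq p : seq C := sval (closed_field_poly_normal p).

Lemma count_mem_zeroseq p z : p != 0 ->
  count_mem z (zeroseq p) = mup z p.
Proof.
move=> p0; rewrite /zeroseq; case: closed_field_poly_normal => s /= ps.
have c0 : lead_coef p != 0 by rewrite lead_coef_eq0.
rewrite [in RHS]ps -mul_polyC mupMr ?mu_prod_XsubC //.
by rewrite rootC.
Qed.

Definition Pinf (L : nat) (Cl om bl : 'I_L -> C) : {poly C} :=
  \sum_(l < L) ((Cl l)^* * om l) *:
    \prod_(k < L | k != l) ('X - ((bl k)^*)%:P).

End OPUC.

(* Main.v *)
Require Import Defs.
From mathcomp Require Import all_boot all_order all_algebra complex.
From mathcomp Require Import all_classical all_reals all_analysis.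
From mathcomp Require Import ring lra zify.
Import Order.TTheory GRing.Theory Num.Theory.
Import numFieldNormedType.Exports.
Local Open Scope complex_scope.
Local Open Scope classical_set_scope.
Local Open Scope ring_scope.

(** Write Phi* for the reversed polynomial and Q(z) = prod_k (z - conj b_k).
Unrolling the recurrence gives
  Phi_n = z^n - sum_{m<n} z^(n-1-m) conj(alpha_m) Phi*_m.
On a disk |z| <= r < b, replacing Phi*_m by Phi*_n and alpha_m by
sum_l C_l b_l^m costs O((b s)^n) for some s < 1, and what is left is a geometric
sum, so that b^-n Q Phi_n - Phi*_n P_n -> 0 uniformly, where P_n is P_infty with
omega^n in place of its limit.  As |Phi*_n| is bounded below on the closed unit
disk, Rouche's theorem compares, on small circles around the zeros of P_infty,
the polynomials b^-n Q Phi_n and Phi*_n P_infty.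

Rouche's theorem for polynomials f, g is obtained without integration.  Suppose
that Re(f conj g) >= e > 0 on the unit circle and that f has more zeros than g in
the disk.  On the circle, conj(z - a) = z^-1 (1 - conj(a) z); dividing f conj g by
the squared modulus of the inner factors of f and the outer factors of g
therefore leaves a rational function without poles in the closed disk, vanishing
at 0, whose real part is bounded below on the circle.  Approximating it by
polynomials contradicts the mean value property, and the latter follows by
passing repeatedly from q(z) to its even part (q(u) + q(-u)) / 2, u^2 = z. *)

(** * Rouche's theorem for polynomials *)

Lemma mean_value_real_part {C : numClosedFieldType} (q : {poly C}) (e : C) :
  (forall z : C, `|z| = 1 -> e <= q.[z] + (q.[z])^*) -> e <= q.[0] + (q.[0])^*.
Proof.
have [n] := ubnP (size q); elim: n q => // n IH q sq hq.
have [sq1|sq1] := leqP (size q) 1.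
  by rewrite (size1_polyC sq1) hornerC in hq *; rewrite -[q`_0](hornerC _ 1) hq ?normr1.
have -> : q.[0] = (even_poly q).[0] by rewrite !horner_coef0 coef_even_poly.
(* The even part has the same value at 0 and, once the size is at least 2, a strictly smaller
   size. *)
apply: IH => [|z z1].
  apply: leq_ltn_trans (size_even_poly q) _.
  by move: sq sq1; rewrite uphalf_half; lia.
pose u := sqrtC z.
have u2 : u ^+ 2 = z by rewrite sqrtCK.
have u1 : `|u| = 1 by apply/eqP; rewrite -(@pexpr_eq1 _ _ 2) // -normrX u2 z1.
have hu := hq u u1.
have hv := hq (- u) ltac:(by rewrite normrN).
have E v : v ^+ 2 = z -> q.[v] = (even_poly q).[z] + (odd_poly q).[z] * v.
  by move=> <-; rewrite -[in LHS](poly_even_odd q) !hornerE !horner_comp !hornerE.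
(* Adding the bounds at the two square roots of [z] cancels the odd part. *)
have := lerD hu hv; rewrite (E u) // (E (- u)) ?sqrrN // !rmorphD !rmorphM !rmorphN.
set x := (even_poly q).[z]; set y := (odd_poly q).[z].
have -> : x + y * u + (x^* + y^* * u^*) + (x + y * - u + (x^* + y^* * - u^*)) =
  (x + x^*) *+ 2 by rewrite mulr2n; ring.
by rewrite -mulr2n lerMn2r.
Qed.

Lemma horner_bounded {C : numClosedFieldType} (p : {poly C}) {r : C} :
  0 <= r -> exists2 M, 0 < M & forall z, `|z| <= r -> `|p.[z]| <= M.
Proof.
move=> r0; have S0 : 0 <= \sum_(i < size p) `|p`_i| * r ^+ i.
  by apply: sumr_ge0 => i _; rewrite mulr_ge0 ?exprn_ge0.
(* The summand [1] keeps the bound positive when [p] is zero. *)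
exists (\sum_(i < size p) `|p`_i| * r ^+ i + 1) => [|z zr].
  by rewrite ltr_wpDl.
rewrite horner_coef; apply: le_trans (ler_norm_sum _ _ _) _.
apply: ler_wpDr => //; apply: ler_sum => i _.
by rewrite normrM normrX ler_wpM2l // lerXn2r ?nnegrE.
Qed.


(** An element of [R[i]] comparable with 0 is real, so [M], [e] and the modulus of [x] come from
    [R], where geometric sequences converge. *)
Lemma exists_exprn_le {R : realType} {x M e : R[i]} :
  0 <= M -> `|x| < 1 -> 0 < e -> exists N, M * `|x| ^+ N <= e.
Proof.
move=> M0 x1 e0.
have EM : M = (complex.Re M)%:C by rewrite RRe_real // ger0_real.
have Ee : e = (complex.Re e)%:C by rewrite RRe_real // gtr0_real.
have Ex : `|x| = (complex.Re `|x|)%:C by rewrite RRe_real.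
have y1 : `|complex.Re `|x| | < 1.
  by rewrite ger0_norm; [rewrite -ltcR -Ex | rewrite -lecR -Ex normr_ge0].
have e0' : 0 < complex.Re e by rewrite -ltcR -Ee.
have /cvgrPdist_lt /(_ _ e0') [N _ /(_ N (leqnn N))] := cvg_geometric (complex.Re M) y1.
rewrite /= sub0r normrN => hN; exists N.
rewrite EM Ee Ex -rmorphXn -rmorphM lecR.
by apply: le_trans (ltW hN); rewrite ler_norm.
Qed.

(** The poles lie outside the closed disk, so the fraction is a uniform limit of polynomials on the
    circle. The value at 0 is preserved because the mean value property is applied there. *)
Lemma prod_inv_disk_approx {R : realType} {bs : seq R[i]} (U : {poly R[i]}) {e : R[i]} :
  0 < e -> all (fun c : R[i] => `|c| < 1) bs ->
  exists2 E : {poly R[i]}, E.[0] = U.[0] &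
    forall z : R[i], `|z| = 1 -> `|U.[z] / \prod_(c <- bs) (1 - c * z) - E.[z]| <= e.
Proof.
elim: bs e => [|c bs IH] e e0 /=.
  by move=> _; exists U => // z z1; rewrite big_nil divr1 subrr normr0 ltW.
move=> /andP[c1 hbs]; have c1' : 0 < 1 - `|c| by rewrite subr_gt0.
(* Dividing by [1 - c * z] multiplies an error by at most [(1 - |c|)^-1], hence this tolerance, and
   the same one for the truncation. *)
have [||F F0 hF] := IH (e / 2 * (1 - `|c|)) => //.
  by rewrite !mulr_gt0 ?invr_gt0.
have [M M0 hM] := horner_bounded F (@ler01 R[i]).
have [|N hN] := @exists_exprn_le _ c M (e / 2 * (1 - `|c|)) (ltW M0) c1.
  by rewrite !mulr_gt0 ?invr_gt0.
(* The factor 1 / (1 - c z) is replaced by a truncated geometric series. *)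
exists (F * \sum_(k < N.+1) (c *: 'X) ^+ k) => [|z z1].
  rewrite hornerM F0 horner_sum big_ord_recl expr0 hornerE big1 ?addr0 ?mulr1 //.
  by move=> i _; rewrite horner_exp hornerZ hornerX mulr0 exprS mul0r.
have -> : (F * \sum_(k < N.+1) (c *: 'X) ^+ k).[z] = F.[z] * \sum_(k < N.+1) (c * z) ^+ k.
  rewrite hornerM horner_sum; congr (_ * _).
  by apply: eq_bigr => k _; rewrite horner_exp hornerZ hornerX.
have cz : `|c * z| = `|c| by rewrite normrM z1 mulr1.
have nz : 1 - c * z != 0.
  by apply/negP; rewrite subr_eq0 => /eqP E1; move: c1; rewrite -cz -E1 normr1 ltxx.
have le1 : 1 - `|c| <= `|1 - c * z|.
  by have := lerB_dist 1 (c * z); rewrite normr1 cz.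
have -> : \sum_(k < N.+1) (c * z) ^+ k = (1 - (c * z) ^+ N.+1) / (1 - c * z).
  apply: (mulIf nz); rewrite divfK //.
  by rewrite -opprB mulrN mulrC -subrX1 opprB.
rewrite big_cons invfM.
set P := \prod_(j <- bs) _.
have -> : U.[z] * ((1 - c * z)^-1 / P) - F.[z] * ((1 - (c * z) ^+ N.+1) / (1 - c * z))
  = ((U.[z] / P - F.[z]) + F.[z] * (c * z) ^+ N.+1) / (1 - c * z).
  by move: P^-1 (c*z) nz => Q d nz; field.
rewrite normrM normfV ler_pdivrMr ?normr_gt0 //.
apply: le_trans (ler_normD _ _) _.
apply: (@le_trans _ _ (e * (1 - `|c|))); last by rewrite ler_pM2l.
have -> : e * (1 - `|c|) = e / 2 * (1 - `|c|) + e / 2 * (1 - `|c|).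
  by rewrite -mulrDl -splitr.
apply: lerD; first exact: hF.
rewrite normrM normrX cz exprS; apply: le_trans hN.
apply: ler_pM; rewrite ?hM ?z1 ?mulr_ge0 ?exprn_ge0 //.
by rewrite ler_piMl ?exprn_ge0 // ltW.
Qed.

(** If [U] vanished at 0, so would a polynomial within [e / 4] of the fraction on the circle. Twice
    its real part there is still at least [e / 2], against the mean value property. *)
Lemma rational_mean_value_neq0 {R : realType} {bs : seq R[i]}
    {U : {poly R[i]}} {e : R[i]} :
  all (fun c : R[i] => `|c| < 1) bs -> 0 < e ->
  (forall z : R[i], `|z| = 1 ->
     e <= U.[z] / \prod_(c <- bs) (1 - c * z) +
       (U.[z] / \prod_(c <- bs) (1 - c * z))^*) ->
  U.[0] != 0.
Proof.
move=> hbs e0 hU; apply/eqP => U0.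
have e4 : 0 < e / 4 by rewrite divr_gt0.
have [E E0 hE] := prod_inv_disk_approx U e4 hbs.
suff /mean_value_real_part : forall z : R[i], `|z| = 1 -> e / 2 <= E.[z] + (E.[z])^*.
  by rewrite E0 U0 rmorph0 addr0 lt_geF ?divr_gt0.
move=> z z1; have := hU z z1; have := hE z z1.
set F := U.[z] / _; set G := E.[z] => hd hF.
have hr : (F - G) + (F - G)^* \is Num.real.
  by rewrite CrealE rmorphD /= conjCK addrC.
have : (F - G) + (F - G)^* <= e / 2.
  apply: le_trans (real_ler_norm hr) _; apply: le_trans (ler_normD _ _) _.
  rewrite norm_conjC; have -> : e / 2 = e / 4 + e / 4 by field.
  exact: lerD.
rewrite rmorphB /= addrACA -opprD lerBlDl => h.
by rewrite -(lerD2r (e / 2)) -splitr; apply: le_trans hF h.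
Qed.

Lemma prod_conj_circle {C : numClosedFieldType} (s : seq C) (z : C) : `|z| = 1 ->
  (\prod_(a <- s) (z - a))^* = z ^- size s * \prod_(a <- s) (1 - a^* * z).
Proof.
move=> z1; have zz : z^* = z^-1 by rewrite invC_norm z1 expr1n invr1 mul1r.
have z0 : z != 0 by rewrite -normr_eq0 z1 oner_eq0.
elim: s => [|a s IH]; first by rewrite !big_nil rmorph1 expr0 invr1 mul1r.
rewrite !big_cons rmorphM /= IH rmorphB /= zz exprS invfM.
have := expf_neq0 (size s) z0.
by move: (z ^+ size s) (bigop _ _ _) => y p y0; field; rewrite y0.
Qed.

(** By contradiction: a surplus of inner zeros of [f] over those of [g] leaves a positive power of
    [z] in the numerator [U] below, so [U] vanishes at 0. *)
Lemma rouche_unit_le {R : realType} (s t : seq R[i]) (c d e : R[i]) :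
  let f (z : R[i]) := c * \prod_(a <- s) (z - a) in
  let g (z : R[i]) := d * \prod_(a <- t) (z - a) in
  0 < e -> (forall z : R[i], `|z| = 1 -> e <= f z * (g z)^* + (f z * (g z)^*)^*) ->
  (count (fun a : R[i] => (`|a| < 1)%R) s <= count (fun a : R[i] => (`|a| < 1)%R) t)%N.
Proof.
move=> f g e0 hfg; rewrite leqNgt; apply/negP => lts.
set D := fun a : R[i] => (`|a| < 1)%R in lts.
pose si := seq.filter D s; pose so := seq.filter (predC D) s.
pose ti := seq.filter D t; pose to := seq.filter (predC D) t.
have splitD r (z : R[i]) : \prod_(a <- r) (z - a) =
    \prod_(a <- seq.filter D r) (z - a) * \prod_(a <- seq.filter (predC D) r) (z - a).
  by rewrite (bigID D) /= !big_filter.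
have f0 z : `|z| = 1 -> f z != 0.
  move=> /hfg h; apply/eqP => E; move: h.
  by rewrite E mul0r rmorph0 addr0 lt_geF.
have g0 z : `|z| = 1 -> g z != 0.
  move=> /hfg h; apply/eqP => E; move: h.
  by rewrite E rmorph0 mulr0 rmorph0 addr0 lt_geF.
(* The filter gives only a weak inequality; it is strict because [g] has no zero on the circle. *)
have out a : a \in to -> 1 < `|a|.
  rewrite mem_filter => /andP[/= aD at_].
  have : 1 <= `|a| by rewrite real_leNgt // ?ger0_real.
  rewrite le_eqVlt => /predU1P[a1|//].
  have /negP[] := g0 a (esym a1).
  rewrite mulf_eq0 prodf_seq_eq0; apply/orP; right; apply/hasP.
  by exists a => //=; rewrite subrr.
have out0 a : a \in to -> a != 0.
  by move=> /out h; rewrite -normr_gt0 (lt_trans _ h).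
(* After division, the denominator consists of the outer factors of [g], written
   [z - a = - a * (1 - z / a)], and of the conjugated inner factors of [f]. The factors [- a] go
   into [K]. *)
pose bs := map (fun a => a^-1) to ++ map (fun a => a^*) si.
have hbs : all (fun b : R[i] => `|b| < 1) bs.
  apply/allP => b; rewrite mem_cat => /orP[] /mapP[a ain ->].
    by rewrite normfV invf_lt1 ?out // (lt_trans _ (out _ ain)).
  by move: ain; rewrite mem_filter norm_conjC => /andP[].
pose K := c * d^* / \prod_(a <- to) (- a).
pose U := K *: 'X^(size si - size ti) * \prod_(a <- so) ('X - a%:P)
  * \prod_(a <- ti) (1 - a^* *: 'X).
(* [M] bounds the divisor on the circle, which turns the lower bound [e] into [e / M ^+ 2]. *)
have [M M0 hM] := horner_bounded
  (\prod_(a <- to) ('X - a%:P) * \prod_(a <- si) ('X - a%:P)) (@ler01 R[i]).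
have szlt : (size ti < size si)%N by rewrite !size_filter.
suff /(rational_mean_value_neq0 hbs) : forall z : R[i], `|z| = 1 ->
    e / M ^+ 2 <= U.[z] / \prod_(b <- bs) (1 - b * z)
      + (U.[z] / \prod_(b <- bs) (1 - b * z))^*.
  rewrite /U !hornerM hornerZ hornerXn expr0n subn_eq0 leqNgt szlt mulr0 !mul0r eqxx.
  by move=> /(_ (divr_gt0 e0 (exprn_gt0 2 M0))).
move=> z z1; have z0 : z != 0 by rewrite -normr_eq0 z1 oner_eq0.
have hornerS (r : seq R[i]) : (\prod_(a <- r) ('X - a%:P)).[z] = \prod_(a <- r) (z - a).
  by rewrite horner_prod; apply: eq_bigr => a _; rewrite hornerXsubC.
set Pto := \prod_(a <- to) (z - a); set Psi := \prod_(a <- si) (z - a).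
have hPM : `|Pto * Psi| <= M by rewrite /Pto /Psi -!hornerS -hornerM hM ?z1.
have P0 : Pto * Psi != 0.
  have := mulf_neq0 (f0 z z1) (g0 z z1).
  rewrite /f /g (splitD s z) (splitD t z) -/Pto -/Psi.
  by rewrite !mulf_eq0 !negb_or => /andP[/and3P[_ -> _] /and3P[_ _ ->]].
have -> : U.[z] / \prod_(b <- bs) (1 - b * z)
    = f z * (g z)^* / `|Pto * Psi| ^+ 2.
  have E1 : \prod_(b <- bs) (1 - b * z) =
      Pto / \prod_(a <- to) (- a) * (z ^+ size si * Psi^*).
    rewrite big_cat !big_map /= prod_conj_circle // mulVKf ?expf_neq0 //.
    congr (_ * _); rewrite -prodf_div; apply: eq_big_seq => a ain.
    by have a0 := out0 a ain; field.
  have E2 : U.[z] = K * z ^+ (size si - size ti) * \prod_(a <- so) (z - a)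
      * (z ^+ size ti * (\prod_(a <- ti) (z - a))^*).
    rewrite /U !hornerM hornerZ hornerXn hornerS prod_conj_circle //.
    rewrite mulVKf ?expf_neq0 //; congr (_ * _).
    by rewrite horner_prod; apply: eq_bigr => a _; rewrite !hornerE.
  have to0 : \prod_(a <- to) (- a) != 0.
    rewrite prodf_seq_neq0; apply/allP => a ain.
    by rewrite oppr_eq0 out0.
  rewrite E1 E2 /f /g /K (splitD s z) (splitD t z) -/Pto -/Psi normCK !rmorphM /=.
  have Ez : z ^+ size si = z ^+ (size si - size ti) * z ^+ size ti.
    by rewrite -exprD subnK // ltnW.
  have := expf_neq0 (size si - size ti) z0; have := expf_neq0 (size ti) z0.
  rewrite Ez; move: P0; rewrite mulf_eq0 negb_or => /andP[].
  move=> n1 n2; have n3 : Pto^* != 0 by rewrite conjC_eq0.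
  have n4 : Psi^* != 0 by rewrite conjC_eq0.
  move: (z ^+ _) (z ^+ _) => x y x0 y0.
  by field; rewrite n1 n2 n3 n4 x0 y0 to0.
have N0 : 0 < `|Pto * Psi| ^+ 2 by rewrite exprn_gt0 ?normr_gt0.
rewrite [in X in _ + X]rmorphM /= fmorphV rmorphXn /= conj_normC -mulrDl.
apply: le_trans (_ : e / `|Pto * Psi| ^+ 2 <= _).
  rewrite ler_pM2l // lef_pV2 ?posrE ?exprn_gt0 ?normr_gt0 //.
  by rewrite lerXn2r ?nnegrE ?normr_ge0 // ltW.
by rewrite ler_pM2r ?invr_gt0 ?hfg.
Qed.

(** The hypothesis is symmetric in [f] and [g], so the one-sided comparison applies both ways. *)
Lemma rouche_unit {R : realType} (s t : seq R[i]) (c d e : R[i]) :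
  let f (z : R[i]) := c * \prod_(a <- s) (z - a) in
  let g (z : R[i]) := d * \prod_(a <- t) (z - a) in
  0 < e -> (forall z : R[i], `|z| = 1 -> e <= f z * (g z)^* + (f z * (g z)^*)^*) ->
  count (fun a : R[i] => (`|a| < 1)%R) s = count (fun a : R[i] => (`|a| < 1)%R) t.
Proof.
move=> f g e0 hfg; apply/eqP; rewrite eqn_leq.
rewrite (@rouche_unit_le _ s t c d e) // (@rouche_unit_le _ t s d c e) // => z z1.
have := hfg z z1; rewrite -/(f z) -/(g z); move: (f z) (g z) => F G.
by rewrite !rmorphM /= !conjCK addrC (mulrC F^*) (mulrC F).
Qed.

(** The substitution [z = w + r * u] reduces to the unit circle. There [|f - g| <= e / 2 <= |f| / 2]
    gives [2 Re (f conj g) >= |f|^2 >= e^2]. *)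
Lemma rouche_disk {R : realType} (s t : seq R[i]) (c d e w r : R[i]) :
  let f (z : R[i]) := c * \prod_(a <- s) (z - a) in
  let g (z : R[i]) := d * \prod_(a <- t) (z - a) in
  0 < r -> 0 < e ->
  (forall z : R[i], `|z - w| = r -> e <= `|f z|) ->
  (forall z : R[i], `|z - w| = r -> `|f z - g z| <= e / 2) ->
  count (fun a : R[i] => (`|a - w| < r)%R) s = count (fun a : R[i] => (`|a - w| < r)%R) t.
Proof.
move=> f g r0 e0 hf hfg.
pose u a : R[i] := (a - w) / r.
have countu v : count (fun a : R[i] => (`|a - w| < r)%R) v =
    count (fun a : R[i] => (`|a| < 1)%R) (map u v).
  rewrite count_map; apply: eq_count => a /=.
  by rewrite /u normrM normfV (gtr0_norm r0) ltr_pdivrMr // mul1r.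
have produ v z : \prod_(a <- v) (w + r * z - a) =
    r ^+ size v * \prod_(a <- map u v) (z - a).
  rewrite big_map; elim: v => [|a v IH]; first by rewrite !big_nil mulr1.
  rewrite !big_cons IH /= exprS /u; have r0' := lt0r_neq0 r0.
  by move: (r ^+ _) (bigop _ _ _) => x y; field.
rewrite !countu.
apply: (@rouche_unit _ _ _ (c * r ^+ size s) (d * r ^+ size t) (e ^+ 2)).
  by rewrite exprn_gt0.
move=> z z1; pose x := w + r * z.
rewrite -(mulrA c) -(mulrA d) -!produ -/x -/(f x) -/(g x).
have hx : `|x - w| = r by rewrite /x addrC addKr normrM z1 mulr1 gtr0_norm.
have := hf x hx; have := hfg x hx.
move: (f x) (g x) => F G h1 h2.
have F0 := lt_le_trans e0 h2.
have -> : F * G^* + (F * G^*)^* = `|F| ^+ 2 *+ 2 - (F * (F - G)^* + (F * (F - G)^*)^*).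
  rewrite normCK !rmorphM !rmorphB /= !conjCK mulr2n; ring.
have hr : F * (F - G)^* + (F * (F - G)^*)^* \is Num.real.
  by rewrite CrealE rmorphD /= conjCK addrC.
have : F * (F - G)^* + (F * (F - G)^*)^* <= `|F| ^+ 2.
  apply: le_trans (real_ler_norm hr) _; apply: le_trans (ler_normD _ _) _.
  rewrite norm_conjC normrM norm_conjC -mulrDr expr2 ler_pM2l //.
  by apply: le_trans h2; rewrite [leRHS](splitr e) lerD.
rewrite mulr2n -addrA -subr_ge0 => h.
apply: (@le_trans _ _ (`|F| ^+ 2)); last by rewrite lerDl.
by rewrite lerXn2r ?nnegrE // ltW.
Qed.

(** * Bounds for the Szego recurrence *)

Lemma PhiS {C : numClosedFieldType} (alpha : nat -> C) n :
  Phi alpha n.+1 =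
  'X * Phi alpha n - (alpha n)^* *: rev_poly n (Phi alpha n).
Proof. by []. Qed.

Lemma rev_Phi_rec {C : numClosedFieldType} (alpha : nat -> C) n :
  rev_poly n.+1 (Phi alpha n.+1) =
  rev_poly n (Phi alpha n) - alpha n *: ('X * Phi alpha n).
Proof.
rewrite PhiS.
have Phi0 k : (n < k)%N -> (Phi alpha n)`_k = 0.
  by move=> nk; rewrite nth_default // size_Phi.
move: (Phi alpha n) Phi0 => p Phi0; rewrite /rev_poly.
apply/polyP => i; rewrite coefB coefZ coefXM !coef_poly coefB coefZ coefXM.
(* The coefficients of index [n.+1] and 0 are treated apart: in each, one of the two terms on the
   right drops out. *)
have [|ltni] := ltnP i n.+2; last first.
  rewrite ltnNge (ltnW ltni) /= Phi0 ?mulr0 ?subrr //; last by lia.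
  by case: i ltni => //= i _; rewrite mulr0 subrr.
rewrite ltnS leq_eqVlt => /predU1P[->|ltin].
  rewrite subnn /= ltnn !sub0r coef_poly ltn0Sn subn0 rmorphN rmorphM /=.
  by rewrite !conjCK.
rewrite ltin subSn // /= coef_poly.
case: i ltin => [|i] ltin.
  by rewrite subn0 ltnn /= !mulr0 !subr0.
have -> : ((n - i.+1).+1 < n.+1)%N by lia.
rewrite /=.
by rewrite rmorphB rmorphM /= !conjCK; congr (_ - _ * p`_ _); lia.
Qed.

Lemma horner_Phi_rec {C : numClosedFieldType} (alpha : nat -> C) n z :
  (Phi alpha n.+1).[z] =
  z * (Phi alpha n).[z] - (alpha n)^* * (rev_poly n (Phi alpha n)).[z].
Proof. by rewrite PhiS !hornerE. Qed.

Lemma horner_rev_Phi_rec {C : numClosedFieldType} (alpha : nat -> C) n z :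
  (rev_poly n.+1 (Phi alpha n.+1)).[z] =
  (rev_poly n (Phi alpha n)).[z] - alpha n * (z * (Phi alpha n).[z]).
Proof. by rewrite rev_Phi_rec !hornerE. Qed.

Lemma horner_rev_Phi0 {C : numClosedFieldType} (alpha : nat -> C) z :
  (rev_poly 0 (Phi alpha 0)).[z] = 1.
Proof.
by rewrite /rev_poly /= horner_poly big_ord_recl big_ord0 coef1 subn0 rmorph1
  expr0 mulr1 addr0.
Qed.

Lemma horner_Phi_sum {C : numClosedFieldType} (alpha : nat -> C) n z :
  (Phi alpha n).[z] = z ^+ n - \sum_(m < n) z ^+ (n.-1 - m) *
    ((alpha m)^* * (rev_poly m (Phi alpha m)).[z]).
Proof.
elim: n => [|n IH]; first by rewrite big_ord0 subr0 hornerC.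
rewrite horner_Phi_rec IH big_ord_recr /= subnn expr0 mul1r opprD addrA.
congr (_ - _); rewrite mulrBr -exprS mulr_sumr; congr (_ - _).
apply: eq_bigr => m _; rewrite mulrA -exprS; congr (_ ^+ _ * _).
by have := ltn_ord m; lia.
Qed.

(** Induction through the identity [|s - a v|^2 - |v - conj(a) s|^2 = (1 - |a|^2) (|s|^2 - |v|^2)],
    with [v = z * p]. *)
Lemma norm_Phi_le {C : numClosedFieldType} {alpha : nat -> C} n {z : C} :
  (forall k, `|alpha k| < 1) -> `|z| <= 1 ->
  `|(Phi alpha n).[z]| <= `|(rev_poly n (Phi alpha n)).[z]|.
Proof.
move=> hal z1; elim: n => [|n IH]; first by rewrite horner_rev_Phi0 hornerC.
rewrite horner_Phi_rec horner_rev_Phi_rec.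
set p := (Phi _ _).[z] in IH *; set s := (rev_poly _ _).[z] in IH *.
have zp : `|z * p| <= `|s|.
  by apply: le_trans IH; rewrite normrM ler_piMl.
rewrite -(@ler_pXn2r _ 2) ?nnegrE // -subr_ge0.
have -> : `|s - alpha n * (z * p)| ^+ 2 - `|z * p - (alpha n)^* * s| ^+ 2 =
    (1 - `|alpha n| ^+ 2) * (`|s| ^+ 2 - `|z * p| ^+ 2).
  by rewrite !normCK !rmorphB !rmorphM /= conjCK; ring.
rewrite mulr_ge0 // subr_ge0 ?lerXn2r ?nnegrE //.
by rewrite expr_le1 // ltW.
Qed.

(** Since [norm_Phi_le] bounds Phi_n by Phi*_n, each step of the recurrence changes Phi*_n by at
    most the fraction [|alpha n|] of its modulus. *)
Lemma rev_Phi_lower {C : numClosedFieldType} {alpha : nat -> C} n {z : C} :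
  (forall k, `|alpha k| < 1) -> `|z| <= 1 ->
  \prod_(k < n) (1 - `|alpha k|) <= `|(rev_poly n (Phi alpha n)).[z]|.
Proof.
move=> hal z1; elim: n => [|n IH]; first by rewrite horner_rev_Phi0 big_ord0 normr1.
rewrite big_ord_recr horner_rev_Phi_rec /=.
apply: le_trans (lerB_dist _ _); rewrite mulrBr mulr1.
have h1 : `|alpha n * (z * (Phi alpha n).[z])| <=
    `|alpha n| * `|(rev_poly n (Phi alpha n)).[z]|.
  rewrite normrM ler_wpM2l // normrM; apply: le_trans (norm_Phi_le n hal z1).
  by rewrite ler_piMl.
apply: le_trans (lerB (lexx _) h1).
rewrite -subr_ge0 (mulrC `|alpha n|) -[X in _ - X * _]mulr1.
set s := `|_.[z]| in IH *; set P := bigop _ _ _ in IH *.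
have -> : s - s * 1 * `|alpha n| - (P - P * `|alpha n|) =
  (s - P) * (1 - `|alpha n|) by ring.
by rewrite mulr_ge0 // subr_ge0 // ltW.
Qed.

Lemma rev_Phi_upper {C : numClosedFieldType} {alpha : nat -> C} n {z : C} :
  (forall k, `|alpha k| < 1) -> `|z| <= 1 ->
  `|(rev_poly n (Phi alpha n)).[z]| <= \prod_(k < n) (1 + `|alpha k|).
Proof.
move=> hal z1; elim: n => [|n IH]; first by rewrite horner_rev_Phi0 big_ord0 normr1.
rewrite big_ord_recr horner_rev_Phi_rec /= mulrDr mulr1.
apply: le_trans (ler_normB _ _) _; apply: lerD => //.
rewrite normrM mulrC ler_wpM2r //; apply: le_trans IH.
rewrite normrM; apply: le_trans (norm_Phi_le n hal z1).
by rewrite ler_piMl.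
Qed.

Lemma geometric_sum_le {C : numFieldType} {s : C} n : 0 <= s < 1 ->
  \sum_(i < n) s ^+ i <= (1 - s)^-1.
Proof.
move=> /andP[s0 s1]; have p : 0 < 1 - s by rewrite subr_gt0.
rewrite -[leRHS]mul1r ler_pdivlMr // mulrC -opprB mulNr -subrX1 opprB.
by rewrite gerBl exprn_ge0.
Qed.

(** Beyond an [N] for which the tail of the dominating series is at most 1/2, the remaining product
    is at least 1 minus that tail; hence half the product up to [N] is a lower bound. *)
Lemma prod_1B_bounded {R : realType} (a : nat -> R[i]) (K b : R[i]) :
  0 <= K -> 0 <= b < 1 -> (forall n, 0 <= a n < 1) ->
  (forall n, a n <= K * b ^+ n) ->
  exists2 c, 0 < c & forall n, c <= \prod_(k < n) (1 - a k).
Proof.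
move=> K0 /[dup] b01 /andP[b0 b1] ha haK.
have b1' : 0 < 1 - b by rewrite subr_gt0.
have f0 k : 0 < 1 - a k by rewrite subr_gt0; case/andP: (ha k).
have P0 n : 0 < \prod_(k < n) (1 - a k) by apply: prodr_gt0.
have [|||N hN] := @exists_exprn_le _ b (K / (1 - b)) (1 / 2).
- by rewrite divr_ge0 // ltW.
- by rewrite ger0_norm.
- by [].
rewrite ger0_norm // in hN.
have anti n k : \prod_(i < n + k) (1 - a i) <= \prod_(i < n) (1 - a i).
  elim: k => [|k IH]; first by rewrite addn0.
  rewrite addnS big_ord_recr /=; apply: le_trans IH.
  by rewrite ler_piMr ?(ltW (P0 _)) // gerBl; case/andP: (ha (n + k)).
set PN := \prod_(k < N) (1 - a k).
have PN0 : 0 < PN by apply: P0.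
exists (PN / 2); first by rewrite divr_gt0.
have low k : PN - PN * (K * b ^+ N) * \sum_(i < k) b ^+ i <=
    \prod_(i < N + k) (1 - a i).
  elim: k => [|k IH]; first by rewrite big_ord0 mulr0 subr0 addn0.
  rewrite addnS !big_ord_recr /= mulrBr mulr1 mulrDr opprD addrA lerB //.
  rewrite -!mulrA; apply: ler_pM => //;
    [exact: (ltW (P0 _)) | by case/andP: (ha (N + k)) | exact: anti |].
  by rewrite -exprD.
move=> n; have [Nn|nN] := leqP N n.
  rewrite -(subnKC Nn); refine (le_trans _ (low (n - N)%N)).
  rewrite -mulrA -[X in X - _]mulr1 -mulrBr ler_pM2l //.
  rewrite lerBrDl -lerBrDr.
  have -> : 1 - 2^-1 = 1 / 2 :> R[i] by field.
  apply: le_trans hN; rewrite mulrAC ler_wpM2r ?exprn_ge0 // ?ler_wpM2l //.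
  exact: geometric_sum_le.
apply: (@le_trans _ _ PN); first by rewrite ler_pdivrMr // ler_peMr ?ler1n // ltW.
by rewrite /PN -(subnKC (ltnW nN)).
Qed.

Lemma rev_Phi_bounded {R : realType} {alpha : nat -> R[i]} {K b : R[i]} :
  0 <= K -> 0 <= b < 1 -> (forall n, `|alpha n| < 1) ->
  (forall n, `|alpha n| <= K * b ^+ n) ->
  exists2 c, 0 < c & forall n z, `|z| <= 1 ->
    c <= `|(rev_poly n (Phi alpha n)).[z]| <= c^-1.
Proof.
move=> K0 b01 hal haK.
have [||c c0 hc] := @prod_1B_bounded _ (fun n => `|alpha n|) K b K0 b01 => //.
  by move=> n; rewrite normr_ge0 hal.
exists c => // n z z1; apply/andP; split.
  exact: le_trans (hc n) (rev_Phi_lower n hal z1).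
apply: le_trans (rev_Phi_upper n hal z1) _.
rewrite -[leRHS]mul1r ler_pdivlMr //.
(* The constant [c] also serves above, because [(1 + x) * (1 - x) <= 1]. *)
apply: (@le_trans _ _ (\prod_(k < n) (1 + `|alpha k|) * \prod_(k < n) (1 - `|alpha k|))).
  by rewrite ler_wpM2l // prodr_ge0 // => k _; rewrite addr_ge0.
rewrite -big_split /=; apply: prodr_ile1 => k _.
rewrite mulr_ge0 ?subr_ge0 ?(ltW (hal _)) ?addr_ge0 //=.
by rewrite mulrC -subr_sqr expr1n gerBl exprn_ge0.
Qed.

(** * Asymptotics inside the disk of radius b *)

(** The increments of Phi*_k are at most [K * c * b ^+ k]; they are summed from [m] on. *)
Lemma rev_Phi_tail {R : realType} {alpha : nat -> R[i]} {K b c : R[i]} m n z :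
  0 <= K -> 0 <= b < 1 -> 0 < c ->
  (forall n, `|alpha n| < 1) -> (forall n, `|alpha n| <= K * b ^+ n) ->
  (forall n, `|(rev_poly n (Phi alpha n)).[z]| <= c) ->
  `|z| <= 1 -> (m <= n)%N ->
  `|(rev_poly m (Phi alpha m)).[z] - (rev_poly n (Phi alpha n)).[z]| <=
    K * c / (1 - b) * b ^+ m.
Proof.
move=> K0 b01 c0 hal haK hc z1 mn.
have b0 : 0 <= b by case/andP: b01.
apply: (@le_trans _ _ (K * c * b ^+ m * \sum_(i < n - m) b ^+ i)); last first.
  rewrite [leRHS]mulrAC ler_wpM2l ?geometric_sum_le //.
  by rewrite !mulr_ge0 ?exprn_ge0 // ltW.
rewrite -(subnKC mn) addKn; elim: (n - m)%N => [|k IH].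
  by rewrite addn0 subrr normr0 big_ord0 mulr0.
rewrite addnS horner_rev_Phi_rec opprB addrCA addrC big_ord_recr /= mulrDr.
apply: le_trans (ler_normD _ _) _; apply: lerD => //.
rewrite normrM -!mulrA (mulrC c) !mulrA -(mulrA K) -exprD.
apply: ler_pM => //; apply: le_trans (hc (m + k)%N).
by rewrite normrM; apply: le_trans (norm_Phi_le _ hal z1); rewrite ler_piMl.
Qed.

(** In the unrolled recurrence, replacing Phi*_m by Phi*_n and conj(alpha_m) by [be m] costs a
    multiple of [(b * s) ^+ m]. The factor [z ^+ (n.-1 - m)] is smaller still, by [s ^+ (n.-1 - m)],
    so the errors add up to a geometric series in [s]. *)
Lemma Phi_asymptotics {R : realType} {alpha be : nat -> R[i]} {K b s : R[i]} :
  0 <= K -> 0 < b < 1 -> 0 < s < 1 -> b <= s ->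
  (forall n, `|alpha n| < 1) -> (forall n, `|alpha n| <= K * b ^+ n) ->
  (forall n, `|(alpha n)^* - be n| <= K * (b * s) ^+ n) ->
  exists2 M, 0 < M & forall n z, `|z| <= b * s ^+ 2 ->
    `|(Phi alpha n).[z] + (rev_poly n (Phi alpha n)).[z] *
       \sum_(m < n) z ^+ (n.-1 - m) * be m| <= M * (b * s) ^+ n.
Proof.
move=> K0 /andP[b0 b1] /andP[s0 s1] bs hal haK hbe.
have b01 : 0 <= b < 1 by rewrite ltW.
have s01 : 0 <= s < 1 by rewrite ltW.
have p1 : 0 < 1 - b by rewrite subr_gt0.
have p2 : 0 < 1 - s by rewrite subr_gt0.
have bs0 : 0 < b * s by rewrite mulr_gt0.
have [c c0 hc] := rev_Phi_bounded K0 b01 hal haK.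
have V0 : 0 < c^-1 by rewrite invr_gt0.
(* The first term comes from [rev_Phi_tail], where [b * b <= b * s]; the second from [hbe]. *)
pose K2 := K * (K * c^-1 / (1 - b)) + K * c^-1.
have K20 : 0 <= K2.
  by rewrite addr_ge0 // !mulr_ge0 // ltW // invr_gt0.
(* The [1] accounts for [z ^+ n]; dividing by [b * s] compensates for the exponent [n.-1]. *)
exists (1 + K2 / (1 - s) / (b * s)) => [|n z hz].
  by rewrite ltr_pwDl // !divr_ge0 // ltW.
have z1 : `|z| <= 1.
  apply: le_trans hz _; rewrite mulr_ile1 ?exprn_ge0 ?ltW //.
  by rewrite exprn_ilt1 // ltW.
have hS m : `|(rev_poly m (Phi alpha m)).[z]| <= c^-1.
  by have /andP[] := hc m z z1.
set Pn := (rev_poly n _).[z].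
have -> : (Phi alpha n).[z] + Pn * \sum_(m < n) z ^+ (n.-1 - m) * be m =
    z ^+ n - \sum_(m < n) z ^+ (n.-1 - m) *
      ((alpha m)^* * (rev_poly m (Phi alpha m)).[z] - be m * Pn).
  rewrite horner_Phi_sum mulr_sumr -addrA addrC [_ + z ^+ n]addrC; congr (_ + _).
  rewrite addrC -sumrB -sumrN; apply: eq_bigr => m _.
  by move: (z ^+ _) => x; ring.
have hbr m : (m < n)%N ->
    `|(alpha m)^* * (rev_poly m (Phi alpha m)).[z] - be m * Pn| <= K2 * (b * s) ^+ m.
  move=> mn.
  have -> : (alpha m)^* * (rev_poly m (Phi alpha m)).[z] - be m * Pn =
    (alpha m)^* * ((rev_poly m (Phi alpha m)).[z] - Pn) + ((alpha m)^* - be m) * Pn.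
    by ring.
  apply: le_trans (ler_normD _ _) _; rewrite !normrM norm_conjC mulrDl; apply: lerD.
    have := rev_Phi_tail m n z K0 b01 V0 hal haK hS z1 (ltnW mn); rewrite -/Pn => ht.
    apply: le_trans (ler_pM _ _ (haK m) ht) _ => //.
    have -> : K * b ^+ m * (K / c / (1 - b) * b ^+ m) =
      K * (K / c / (1 - b)) * (b * b) ^+ m by rewrite exprMn; ring.
    rewrite ler_wpM2l ?mulr_ge0 ?(ltW V0) ?invr_ge0 ?(ltW p1) //.
    by rewrite lerXn2r ?nnegrE ?mulr_ge0 ?(ltW b0) ?(ltW s0) // ler_pM2l.
  by rewrite mulrAC; apply: ler_pM => //; exact: hS.
apply: le_trans (ler_normB _ _) _; rewrite mulrDl mul1r; apply: lerD.
  rewrite normrX lerXn2r ?nnegrE ?(ltW bs0) //; apply: le_trans hz _.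
  by rewrite ler_pM2l // expr2 ger_pMl // ltW.
case: n @Pn hbr => [|n] Pn hbr.
  by rewrite big_ord0 normr0 expr0 mulr1 !divr_ge0 // ltW.
rewrite [(b * s) ^+ n.+1]exprS mulrA divfK ?lt0r_neq0 //.
apply: le_trans (ler_norm_sum _ _ _) _.
apply: (@le_trans _ _ (K2 * (b * s) ^+ n * \sum_(m < n.+1) s ^+ m)); last first.
  rewrite [leRHS]mulrAC ler_wpM2l ?geometric_sum_le //.
  by rewrite mulr_ge0 ?exprn_ge0 // ltW.
rewrite mulr_sumr (reindex_inj rev_ord_inj); apply: ler_sum => m _ /=.
have mn : (m <= n)%N by rewrite -ltnS.
rewrite subSS subKn // normrM.
apply: (@le_trans _ _ ((b * s ^+ 2) ^+ m * (K2 * (b * s) ^+ (n - m)))).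
  apply: ler_pM => //; last by apply: hbr; rewrite ltnS leq_subr.
  by rewrite normrX lerXn2r ?nnegrE // mulr_ge0 ?exprn_ge0 ?ltW.
have -> : (b * s) ^+ n = (b * s) ^+ (n - m) * (b * s) ^+ m.
  by rewrite -exprD subnK.
have -> : b * s ^+ 2 = b * s * s by rewrite expr2 mulrA.
rewrite (exprMn m (b * s) s) le_eqVlt; apply/orP; left; apply/eqP.
by move: (s ^+ _) ((b * s) ^+ _) ((b * s) ^+ _) => *; ring.
Qed.

Lemma horner_Pinf {C : numClosedFieldType} L (Cl om bl : 'I_L -> C) z :
  (Pinf Cl om bl).[z] =
  \sum_(l < L) (Cl l)^* * om l * \prod_(k < L | k != l) (z - (bl k)^*).
Proof.
rewrite /Pinf horner_sum; apply: eq_bigr => l _; rewrite hornerZ horner_prod.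
by congr (_ * _); apply: eq_bigr => k _; rewrite hornerXsubC.
Qed.

(** Each inner geometric sum times [z - (bl l)^*] is [z ^+ n - (bl l)^* ^+ n]. Without division, the
    identity also covers [z = (bl l)^*]. *)
Lemma prod_geometric_sum {C : numClosedFieldType} L (Cl bl : 'I_L -> C) n z :
  \prod_(k < L) (z - (bl k)^*) *
    \sum_(m < n) z ^+ (n.-1 - m) * \sum_(l < L) (Cl l)^* * (bl l)^* ^+ m =
  z ^+ n * (Pinf Cl (fun=> 1) bl).[z] - (Pinf Cl (fun l => (bl l)^* ^+ n) bl).[z].
Proof.
transitivity (\sum_(l < L) (Cl l)^* * (z ^+ n - (bl l)^* ^+ n) *
    \prod_(k < L | k != l) (z - (bl k)^*)); last first.
  rewrite !horner_Pinf [X in X - _]mulr_sumr -sumrB; apply: eq_bigr => l _.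
  by move: (bigop _ _ _) (z ^+ n) (_ ^+ n) => *; ring.
have -> : \sum_(m < n) z ^+ (n.-1 - m) * \sum_(l < L) (Cl l)^* * (bl l)^* ^+ m =
    \sum_(l < L) (Cl l)^* * \sum_(m < n) z ^+ (n.-1 - m) * (bl l)^* ^+ m.
  under eq_bigr => m _ do rewrite mulr_sumr.
  under [RHS]eq_bigr => l _ do rewrite mulr_sumr.
  rewrite exchange_big; apply: eq_bigr => l _; apply: eq_bigr => m _.
  exact: mulrCA.
rewrite mulr_sumr; apply: eq_bigr => l _; rewrite (bigD1 l) //= subrXX.
by move: (bigop _ _ _) (bigop _ _ _) => *; ring.
Qed.

(** [Phi_asymptotics] is multiplied by Q and divided by [b ^+ n]. Of the geometric sum, the part
    carrying [z ^+ n] joins the error, as [|z| <= b * s]. *)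
Lemma Phi_asymptotics_Pinf {R : realType} {L} {Cl bl : 'I_L -> R[i]}
    {alpha : nat -> R[i]} {K b s : R[i]} :
  0 <= K -> 0 < b < 1 -> 0 < s < 1 -> b <= s -> (forall l, `|bl l| = b) ->
  (forall n, `|alpha n| < 1) -> (forall n, `|alpha n| <= K * b ^+ n) ->
  (forall n, `|alpha n - \sum_(l < L) Cl l * bl l ^+ n| <= K * (b * s) ^+ n) ->
  exists2 M, 0 < M & forall n z, `|z| <= b * s ^+ 2 ->
    `|b ^- n * (\prod_(k < L) (z - (bl k)^*) * (Phi alpha n).[z]) -
      (rev_poly n (Phi alpha n)).[z] *
      (Pinf Cl (fun l => ((bl l)^* / b) ^+ n) bl).[z]| <= M * s ^+ n.
Proof.
move=> K0 hb hs bs hbl hal haK hdiff.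
pose be n := \sum_(l < L) (Cl l)^* * (bl l)^* ^+ n.
have hbe n : `|(alpha n)^* - be n| <= K * (b * s) ^+ n.
  apply: le_trans (hdiff n); rewrite -[leRHS]norm_conjC rmorphB rmorph_sum /=.
  rewrite (eq_bigr (fun l => (Cl l)^* * (bl l)^* ^+ n)) // => l _.
  by rewrite rmorphM rmorphXn.
have [M1 M10 hM1] := Phi_asymptotics K0 hb hs bs hal haK hbe.
have /andP[b0 b1] := hb; have /andP[s0 s1] := hs.
have b01 : 0 <= b < 1 by rewrite ltW.
have [c c0 hc] := rev_Phi_bounded K0 b01 hal haK.
have [M2 M20 hM2] := horner_bounded (Pinf Cl (fun=> 1) bl) (@ler01 R[i]).
have [M3 M30 hM3] := horner_bounded (\prod_(k < L) ('X - ((bl k)^*)%:P)) (@ler01 R[i]).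
exists (M3 * M1 + c^-1 * M2) => [|n z hz].
  by rewrite addr_gt0 // !mulr_gt0 ?invr_gt0.
have z1 : `|z| <= 1.
  apply: le_trans hz _; rewrite mulr_ile1 ?exprn_ge0 ?ltW //.
  by rewrite exprn_ilt1 // ltW.
have bn0 : 0 < b ^+ n by rewrite exprn_gt0.
rewrite -(ler_pM2l bn0) -[X in X * _ <= _](ger0_norm (ltW bn0)) -normrM mulrBr.
rewrite mulVKf ?lt0r_neq0 //.
rewrite mulrCA (mulrCA (b ^+ n)).
have -> : b ^+ n * (Pinf Cl (fun l => ((bl l)^* / b) ^+ n) bl).[z] =
    (Pinf Cl (fun l => (bl l)^* ^+ n) bl).[z].
  rewrite !horner_Pinf mulr_sumr; apply: eq_bigr => l _.
  rewrite mulrA; congr (_ * _); rewrite mulrCA; congr (_ * _).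
  by rewrite expr_div_n mulrC divfK ?lt0r_neq0.
have -> : (Pinf Cl (fun l => (bl l)^* ^+ n) bl).[z] =
    z ^+ n * (Pinf Cl (fun=> 1) bl).[z] - \prod_(k < L) (z - (bl k)^*) *
    \sum_(m < n) z ^+ (n.-1 - m) * be m.
  by rewrite prod_geometric_sum opprB addrC subrK.
set Q := \prod_(k < L) _; set S := \sum_(m < n) _; set P := (Pinf _ _ _).[z].
set f := (Phi alpha n).[z]; set g := (rev_poly n _).[z].
have -> : Q * f - g * (z ^+ n * P - Q * S) = Q * (f + g * S) - z ^+ n * (g * P).
  by move: (z ^+ n) => x; ring.
apply: le_trans (ler_normB _ _) _.
rewrite -exprMn mulrDl; apply: lerD; rewrite normrM.
  rewrite -mulrA; apply: ler_pM => //; last exact: hM1.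
  have := hM3 z z1; rewrite horner_prod (eq_bigr (fun k => z - (bl k)^*)) //.
  by move=> k _; rewrite hornerXsubC.
rewrite mulrC; apply: ler_pM => //.
  by rewrite normrM; apply: ler_pM => //; [case/andP: (hc n z z1) | exact: hM2].
rewrite normrX lerXn2r ?nnegrE ?mulr_ge0 ?(ltW b0) ?(ltW s0) //; apply: le_trans hz _.
by rewrite ler_pM2l // expr2 ger_pMl // ltW.
Qed.

(** The finitely many ratios before [N] are added to the constant. *)
Lemma eventually_dominated {C : numFieldType} (u v : nat -> C) (k : C) N :
  0 <= k -> (forall n, 0 < v n) -> (forall n, (N <= n)%N -> `|u n| <= k * v n) ->
  exists2 K, 0 <= K & forall n, `|u n| <= K * v n.
Proof.
move=> k0 v0 hN; have t0 i : 0 <= `|u i| / v i by rewrite divr_ge0 // ltW.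
exists (k + \sum_(i < N) `|u i| / v i) => [|n].
  by rewrite addr_ge0 // sumr_ge0.
have [/hN h|nN] := leqP N n.
  by apply: le_trans h _; rewrite ler_wpM2r ?(ltW (v0 n)) // lerDl sumr_ge0.
rewrite -ler_pdivrMr // (bigD1 (Ordinal nN)) //= addrCA lerDl addr_ge0 //.
by rewrite sumr_ge0.
Qed.

(** This yields one radius for finitely many smallness conditions; entries that are not positive
    impose none. *)
Lemma min_positive {R : realType} (t : seq R[i]) :
  exists2 d : R, 0 < d & forall x, x \in t -> 0 < x -> d%:C <= x.
Proof.
elim: t => [|y t [d d0 hd]]; first by exists 1.
have [y0|y0] := boolP (0 < y); last first.
  exists d => // x; rewrite inE => /predU1P[->|]; last exact: hd.
  by move=> h; rewrite h in y0.
have Ey : y = (complex.Re y)%:C by rewrite RRe_real // gtr0_real.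
exists (Order.min d (complex.Re y)) => [|x].
  by rewrite lt_min d0 -ltcR -Ey.
rewrite inE => /predU1P[->|/hd h] x0; first by rewrite [leRHS]Ey lecR ge_min lexx orbT.
by apply: le_trans (h x0); rewrite lecR ge_min lexx.
Qed.

(** [Pinf] is linear in [om], with coefficients bounded on the unit disk. *)
Lemma Pinf_uniformly_continuous {R : realType} {L} (Cl bl : 'I_L -> R[i]) (e : R[i]) :
  0 < e -> exists2 d, 0 < d & forall om om' : 'I_L -> R[i],
    (forall l, `|om l - om' l| <= d) ->
    forall z, `|z| <= 1 -> `|(Pinf Cl om bl).[z] - (Pinf Cl om' bl).[z]| <= e.
Proof.
move=> e0.
have /fin_all_exists[M hM] : forall l : 'I_L, exists M, forall z : R[i], `|z| <= 1 ->
    `|(\prod_(k < L | k != l) ('X - ((bl k)^*)%:P)).[z]| <= M.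
  move=> l; have [M _ hM] := horner_bounded
    (\prod_(k < L | k != l) ('X - ((bl k)^*)%:P)) (@ler01 R[i]).
  by exists M.
have M0 l : 0 <= M l by apply: le_trans (hM l 0 _); rewrite ?normr0.
pose S := 1 + \sum_(l < L) `|Cl l| * M l.
have S0 : 0 < S by rewrite ltr_wpDr // sumr_ge0 // => l _; rewrite mulr_ge0.
exists (e / S) => [|om om' hd z z1]; first by rewrite divr_gt0.
rewrite /Pinf !horner_sum -sumrB.
apply: le_trans (ler_norm_sum _ _ _) _.
apply: (@le_trans _ _ (e / S * \sum_(l < L) `|Cl l| * M l)); last first.
  by rewrite mulrAC ler_pdivrMr // ler_pM2l // lerDr.
rewrite mulr_sumr; apply: ler_sum => l _.
rewrite !hornerZ -mulrBl -mulrBr !normrM norm_conjC -mulrA mulrCA.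
by apply: ler_pM => //; apply: ler_pM => //; exact: hM.
Qed.

Lemma Phi_uniform_limit {R : realType} {L : nat} {b Delta : R}
    {bl Cl : 'I_L -> R[i]} {alpha : nat -> R[i]} {n_ : nat -> nat}
    {om : 'I_L -> R[i]} :
  0 < b < 1 -> 0 < Delta < 1 -> (forall l, `|bl l| = b%:C) ->
  (forall n, `|alpha n| < 1) ->
  (fun n => alpha n - \sum_(l < L) Cl l * bl l ^+ n : R[i]^o)
      =O_\oo (fun n => ((b * Delta) ^+ n)%:C : R[i]^o) ->
  (forall i j, (i < j)%N -> (n_ i < n_ j)%N) ->
  (forall l,
    ((((bl l)^* / b%:C) ^+ n_ j : R[i]^o) @[j --> \oo] --> (om l : R[i]^o))) ->
  exists2 c, 0 < c &
    (forall n z, `|z| <= 1 -> c <= `|(rev_poly n (Phi alpha n)).[z]|) /\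
    forall (r : R) (e : R[i]), r < b -> 0 < e ->
    exists N, forall j, (N <= j)%N -> forall z, `|z| <= r%:C ->
    `|b%:C ^- n_ j * (\prod_(k < L) (z - (bl k)^*) * (Phi alpha (n_ j)).[z]) -
      (rev_poly (n_ j) (Phi alpha (n_ j))).[z] * (Pinf Cl om bl).[z]| <= e.
Proof.
move=> hb /andP[D0 D1] hbl hal hO hn hom; have /andP[b0 b1] := hb.
have [K1 K10 hK1] : exists2 K, 0 <= K & forall n,
    `|alpha n - \sum_(l < L) Cl l * bl l ^+ n| <= K * ((b * Delta) ^+ n)%:C.
  have /eqO_exP[k k0 [N _ hN]] := hO.
  apply: (@eventually_dominated _ _ _ k N (ltW k0)) => n.
    by rewrite ltcR exprn_gt0 // mulr_gt0.
  move=> /hN /=; rewrite [X in _ * X]ger0_norm // lecR exprn_ge0 //.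
  by rewrite mulr_ge0 // ltW.
pose K := K1 + \sum_(l < L) `|Cl l|.
have SC0 : 0 <= \sum_(l < L) `|Cl l| by rewrite sumr_ge0.
have K0 : 0 <= K by rewrite addr_ge0.
have hK n : `|alpha n| <= K * b%:C ^+ n.
  rewrite -[alpha n](subrK (\sum_(l < L) Cl l * bl l ^+ n)).
  apply: le_trans (ler_normD _ _) _; rewrite mulrDl; apply: lerD.
    apply: le_trans (hK1 n) _; rewrite ler_wpM2l // -rmorphXn lecR.
    by rewrite lerXn2r ?nnegrE ?mulr_ge0 ?(ltW b0) ?(ltW D0) // ger_pMr // ltW.
  apply: le_trans (ler_norm_sum _ _ _) _; rewrite mulr_suml; apply: ler_sum => l _.
  by rewrite normrM normrX hbl.
have hbC : 0 < b%:C < 1 by rewrite !ltcR.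
have b01 : 0 <= b%:C < 1 by case/andP: hbC => /ltW -> ->.
have [c c0 hc] := rev_Phi_bounded K0 b01 hal hK.
exists c => //; split=> [n z z1|r e rb e0]; first by case/andP: (hc n z z1).
(* One ratio below 1 covers the disk radius, the decay of the coefficients and their error term. *)
pose t := Order.max (r / b) (Order.max b Delta).
have t1 : t < 1 by rewrite !gt_max ltr_pdivrMr // mul1r rb b1.
have [rt bt Dt] : [/\ r <= b * t, b <= t & Delta <= t].
  by split; rewrite -?ler_pdivrMl // 1?mulrC !le_max lexx ?orbT.
(* The square leaves a spare factor [s], which makes the error sum geometric. *)
have [s [s0 s1 ts ts2]] : exists s : R, [/\ 0 < s, s < 1, t <= s & t <= s ^+ 2].
  by exists ((1 + t) / 2); split; nra.
have hdiff n : `|alpha n - \sum_(l < L) Cl l * bl l ^+ n| <= K * (b%:C * s%:C) ^+ n.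
  apply: le_trans (hK1 n) _; apply: ler_pM => //.
  - by rewrite lecR exprn_ge0 // mulr_ge0 // ltW.
  - by rewrite lerDl.
  rewrite -rmorphM -rmorphXn lecR lerXn2r ?nnegrE ?mulr_ge0 ?(ltW b0) ?(ltW D0) ?(ltW s0) //.
  by rewrite ler_pM2l // (le_trans Dt).
have hsC : 0 < s%:C < 1 by rewrite !ltcR s0.
have bsC : b%:C <= s%:C by rewrite lecR (le_trans bt).
have [M M0 hM] := Phi_asymptotics_Pinf K0 hbC hsC bsC hbl hal hK hdiff.
have [|N1 hN1] := @exists_exprn_le _ s%:C M (e / 2) (ltW M0) _ (divr_gt0 e0 (ltr0n _ 2)).
  by rewrite gtr0_norm; case/andP: hsC.
rewrite gtr0_norm in hN1; last by case/andP: hsC.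
(* The factor [c] offsets the bound [c^-1] on Phi*_n. *)
have [|d d0 hd] := @Pinf_uniformly_continuous _ _ Cl bl (c * (e / 2)).
  by rewrite !mulr_gt0.
have [N2 hN2] : exists N, forall j, (N <= j)%N -> forall l,
    `|((bl l)^* / b%:C) ^+ n_ j - om l| <= d.
  have : \forall j \near \oo, forall l : 'I_L, `|((bl l)^* / b%:C) ^+ n_ j - om l| <= d.
    apply: filter_forall => l; have /cvgrPdist_le /(_ d d0) := hom l.
    by apply: filterS => j; rewrite distrC.
  by move=> [N _ hN]; exists N => j /hN.
have leqn j : (j <= n_ j)%N.
  by elim: j => // j IH; apply: leq_ltn_trans IH (hn _ _ _).
exists (maxn N1 N2) => j; rewrite geq_max => /andP[N1j N2j] z hz.
have hz2 : `|z| <= b%:C * s%:C ^+ 2.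
  apply: le_trans hz _; rewrite -rmorphXn -rmorphM lecR.
  by apply: le_trans rt _; rewrite ler_pM2l.
have z1 : `|z| <= 1 by apply: le_trans hz _; rewrite lecR ltW // (lt_trans rb).
set n := n_ j; set A := b%:C ^- n * _; set g := (rev_poly n _).[z].
pose P1 := (Pinf Cl (fun l => ((bl l)^* / b%:C) ^+ n) bl).[z].
rewrite -(subrK (g * P1) A) -addrA -mulrBr.
apply: le_trans (ler_normD _ _) _; rewrite [leRHS](splitr e); apply: lerD.
  apply: le_trans (hM n z hz2) _; apply: le_trans hN1; rewrite ler_pM2l //.
  by case/andP: hsC => /ltW ? /ltW ?; rewrite ler_wiXn2l // (leq_trans N1j).
rewrite normrM; have /andP[_ hg] := hc n z z1.
apply: le_trans (ler_pM _ _ hg (hd _ _ (hN2 j N2j) z z1)) _ => //.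
by rewrite mulKf // lt0r_neq0.
Qed.

(** * Zeros *)

Lemma zeroseqE {C : numClosedFieldType} (p : {poly C}) z :
  p.[z] = lead_coef p * \prod_(a <- zeroseq p) (z - a).
Proof.
rewrite /zeroseq; case: closed_field_poly_normal => t /= {1}->.
rewrite hornerZ horner_prod; congr (_ * _).
by apply: eq_bigr => a _; rewrite hornerXsubC.
Qed.

Lemma mem_zeroseq {C : numClosedFieldType} {p : {poly C}} {z : C} :
  z \in zeroseq p -> p.[z] = 0.
Proof.
move=> zp; rewrite zeroseqE; apply/eqP; rewrite mulf_eq0 prodf_seq_eq0.
by apply/orP; right; apply/hasP; exists z => //=; rewrite subrr.
Qed.

Lemma horner_zeroseq_ge {C : numClosedFieldType} (p : {poly C}) (d z : C) :
  0 <= d -> (forall a, a \in zeroseq p -> d <= `|z - a|) ->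
  `|lead_coef p| * d ^+ size (zeroseq p) <= `|p.[z]|.
Proof.
move=> d0 hd; rewrite zeroseqE normrM ler_wpM2l //.
elim: (zeroseq p) hd => [|a t IH] hd; first by rewrite big_nil normr1.
rewrite big_cons normrM /= exprS; apply: ler_pM; rewrite ?exprn_ge0 ?hd ?mem_head //.
by apply: IH => x xt; apply: hd; rewrite inE xt orbT.
Qed.

Lemma horner_phi {C : numClosedFieldType} {alpha : nat -> C} n :
  (forall k, `|alpha k| < 1) ->
  exists2 k, k != 0 & forall z, (Phi alpha n).[z] = k * (phi alpha n).[z].
Proof.
move=> hal; have k0 : \prod_(j < n) sqrtC (1 - `|alpha j| ^+ 2) != 0.
  apply/prodf_neq0 => j _; rewrite sqrtC_eq0 subr_eq0 eq_sym lt_eqF //.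
  by rewrite exprn_ilt1.
exists (\prod_(j < n) sqrtC (1 - `|alpha j| ^+ 2)) => // z.
by rewrite /phi hornerZ mulVKf.
Qed.

(** At [(bl l)^*] only the summand of index [l] survives. *)
Lemma Pinf_neq0 {C : numClosedFieldType} {L} (Cl om bl : 'I_L -> C) l :
  injective bl -> Cl l != 0 -> om l != 0 -> Pinf Cl om bl != 0.
Proof.
move=> ibl C0 om0; apply/eqP => P0.
have : (Pinf Cl om bl).[(bl l)^*] != 0.
  rewrite horner_Pinf (bigD1 l) //= [X in _ + X]big1 ?addr0; last first.
    by move=> k kl; rewrite (bigD1 l) 1?eq_sym //= subrr mul0r mulr0.
  rewrite mulf_eq0 negb_or mulf_neq0 ?conjC_eq0 //=; apply/prodf_neq0 => k kl.
  by rewrite subr_eq0 (inj_eq (can_inj conjCK)) (inj_eq ibl) eq_sym.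
by rewrite P0 horner0 eqxx.
Qed.

Theorem theorem4p2 (R : realType) (L : nat) (hL : (1 <= L)%N)
  (b : R) (hb : 0 < b < 1) (Delta : R) (hDelta : 0 < Delta < 1)
  (bl : 'I_L -> R[i]) (bl_inj : injective bl)
  (bl_norm : forall l, `|bl l| = b%:C)
  (Cl : 'I_L -> R[i]) (Cl_neq0 : forall l, Cl l != 0)
  (alpha : nat -> R[i]) (alpha_disk : forall n, `|alpha n| < 1)
  (alpha_asymp :
    (fun n => alpha n - \sum_(l < L) Cl l * bl l ^+ n : R[i]^o)
      =O_\oo (fun n => ((b * Delta) ^+ n)%:C : R[i]^o))
  (n_ : nat -> nat) (n_gt0 : forall j, (0 < n_ j)%N)
  (n_incr : forall i j, (i < j)%N -> (n_ i < n_ j)%N)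
  (omega_inf : 'I_L -> R[i])
  (omega_lim : forall l,
    ((((bl l)^* / b%:C) ^+ n_ j : R[i]^o) @[j --> \oo] --> (omega_inf l : R[i]^o)))
  (w : seq R[i])
  (w_zeros : perm_eq w
    [seq z <- zeroseq (Pinf Cl omega_inf bl) | `|z| < b%:C]) :
  exists2 delta0 : R, 0 < delta0 &
    forall delta : R, 0 < delta < delta0 ->
      exists N : nat, forall j : nat, (N <= j)%N ->
        (forall z : R[i], z \in w ->
          count (fun x => `|x - z| < delta%:C) (zeroseq (phi alpha (n_ j)))
            = count_mem z w) /\
        (forall x : R[i], root (phi alpha (n_ j)) x ->
          `|x| < (b - delta)%:C ->
          exists2 z : R[i], z \in w & `|x - z| < delta%:C).
Proof.
have /andP[b0 b1] := hb.
have bC : 0 < b%:C by rewrite ltcR.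
set P := Pinf Cl omega_inf bl in w_zeros.
have P0 : P != 0.
  pose l0 : 'I_L := Ordinal hL; apply: (@Pinf_neq0 _ _ _ _ _ l0) => //.
  (* A limit of numbers of modulus 1 is not 0. *)
  have /cvgrPdist_lt /(_ 1 ltr01) [N _ /(_ N (leqnn N)) /=] := omega_lim l0.
  apply: contraTneq => ->; rewrite sub0r normrN normrX normrM norm_conjC bl_norm.
  by rewrite normfV (gtr0_norm bC) divff ?lt0r_neq0 // expr1n ltxx.
have lP0 : 0 < `|lead_coef P| by rewrite normr_gt0 lead_coef_eq0.
pose sP := zeroseq P.
have wP z : (z \in w) = (`|z| < b%:C) && (z \in sP).
  by rewrite (perm_mem w_zeros) mem_filter.
(* The list holds half the distances from the zeros of [P] to the circle of radius [b] and half
   their mutual distances: small disks about the [w_i] stay inside and meet no other zero of [P]. *)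
have [d d0 hd] := min_positive (b%:C / 2 :: [seq (b%:C - `|a|) / 2 | a <- sP] ++
  [seq `|a - a'| / 2 | a <- sP, a' <- sP]).
exists d => // delta /andP[delta0 deltad].
have d0C : 0 < delta%:C by rewrite ltcR.
have ddC : delta%:C < d%:C by rewrite ltcR.
have dw z : z \in w -> `|z| + delta%:C *+ 2 < b%:C.
  rewrite wP => /andP[zb zP].
  have : d%:C <= (b%:C - `|z|) / 2.
    apply: hd; last by rewrite divr_gt0 // subr_gt0.
    by rewrite inE mem_cat; apply/orP; right; apply/orP; left; apply/mapP; exists z.
  rewrite ler_pdivlMr // => /(lt_le_trans (_ : delta%:C * 2 < d%:C * 2)).
  by rewrite ltr_pM2r // mulr_natr ltrBrDl; exact.
have dsep z a : z \in sP -> a \in sP -> z != a -> delta%:C *+ 2 < `|z - a|.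
  move=> zP aP za.
  have : d%:C <= `|z - a| / 2.
    apply: hd; last by rewrite divr_gt0 // normr_gt0 subr_eq0.
    rewrite inE mem_cat; apply/orP; right; apply/orP; right.
    by apply/allpairsP; exists (z, a).
  rewrite ler_pdivlMr // => /(lt_le_trans (_ : delta%:C * 2 < d%:C * 2)).
  by rewrite ltr_pM2r // mulr_natr; exact.
pose r := b - delta.
have rb : r < b by rewrite gtrBl.
have [c c0 [hc hunif]] :=
  Phi_uniform_limit hb hDelta bl_norm alpha_disk alpha_asymp n_incr omega_lim.
(* Lower bound for Phi*_n [P] at points of the smaller disk at distance at least [delta] from the
   zeros of [P]. *)
pose e := c * (`|lead_coef P| * delta%:C ^+ size sP).
have e0 : 0 < e by rewrite !mulr_gt0 ?exprn_gt0.
have [N hN] := hunif r (e / 2) rb (divr_gt0 e0 (ltr0n _ 2)).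
have r1 (z : R[i]) : `|z| <= r%:C -> `|z| <= 1.
  by move=> /le_trans; apply; rewrite lecR ltW // (lt_trans rb).
exists N => j /hN; move: (n_ j) => n hn.
have [k k0 hphi] := horner_phi n alpha_disk.
set g := rev_poly n (Phi alpha n) in hn hc *.
have low z : `|z| <= r%:C -> (forall a, a \in sP -> delta%:C <= `|z - a|) ->
    e <= `|g.[z] * P.[z]|.
  move=> zr hz; rewrite normrM; apply: ler_pM; rewrite ?(ltW c0) //.
  - by rewrite mulr_ge0 ?exprn_ge0 // ltW.
  - by apply: hc; exact: r1.
  - by apply: horner_zeroseq_ge => //; rewrite ltW.
split=> [z zw|x rx xr].
  have zr x : `|x - z| <= delta%:C -> `|x| <= r%:C.
    move=> xz; apply: (@le_trans _ _ (`|x - z| + `|z|)).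
      by rewrite -{1}[x](subrK z) ler_normD.
    rewrite rmorphB /= lerBrDr; apply: le_trans (ltW (dw z zw)).
    by rewrite mulr2n addrA lerD2r [leLHS]addrC lerD2l.
  have /andP[zb zP] : (`|z| < b%:C) && (z \in sP) by rewrite -wP.
  have -> : count_mem z w = count (fun a => `|a - z| < delta%:C) sP.
    rewrite (permP w_zeros) count_filter; apply: eq_in_count => a aP /=.
    have [->|az] := eqVneq a z; first by rewrite subrr normr0 d0C zb.
    rewrite distrC; apply/esym/negbTE/negP => /ltW h.
    have := dsep z a zP aP; rewrite eq_sym => /(_ az) /lt_le_trans/(_ h).
    by rewrite mulr2n gtrDl lt_gtF.
  (* Rouche compares Phi*_n [P] with b^-n Q Phi_n on the circle about [z]. Neither Phi*_n nor Q has
     zeros inside: the former has none in the unit disk, those of the latter have modulus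
     [b > r]. *)
  have := @rouche_disk R (zeroseq g ++ sP)
    ([seq (bl k)^* | k <- enum 'I_L] ++ zeroseq (phi alpha n))
    (lead_coef g * lead_coef P) (b%:C ^- n * k * lead_coef (phi alpha n)) e z delta%:C.
  rewrite !count_cat.
  have -> : count (fun a : R[i] => `|a - z| < delta%:C) (zeroseq g) = 0%N.
    apply/eqP; rewrite -leqn0 leqNgt -has_count; apply/hasPn => a ag.
    apply/negP => /ltW /zr /r1 /(hc n).
    by rewrite (mem_zeroseq ag) normr0 lt_geF.
  have -> : count (fun a : R[i] => `|a - z| < delta%:C) [seq (bl k)^* | k <- enum 'I_L] = 0%N.
    apply/eqP; rewrite -leqn0 leqNgt -has_count; apply/hasPn => a /mapP[l _ ->].
    apply/negP => /ltW /zr; rewrite norm_conjC bl_norm lecR.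
    by rewrite leNgt rb.
  rewrite !add0n; cbv zeta => -> //.
  - move=> x xz; rewrite big_cat mulrACA -!zeroseqE; apply: low => [|a aP].
      by apply: zr; rewrite xz.
    have [<-|za] := eqVneq z a; first by rewrite xz.
    have := le_trans (ltW (dsep z a zP aP za)) (ler_distD x z a).
    by rewrite distrC xz mulr2n lerD2l.
  - move=> x xz; rewrite !big_cat mulrACA -!zeroseqE big_map big_enum /= distrC.
    have := hn x (zr x _); rewrite xz lexx => /(_ isT).
    rewrite hphi zeroseqE; set Q := \prod_(k < L) _; set Z := \prod_(a <- _) _.
    by rewrite -[_ * (Q * Z)]mulrA (mulrCA _ Q Z) -!mulrA (mulrCA k Q) (mulrCA Q).
(* At a zero of [phi] far from all [w_i], Phi*_n [P] would have modulus at most [e / 2] by the limit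
   and at least [e] by [low]. *)
apply: contrapT => hw.
have hx a : a \in sP -> delta%:C <= `|x - a|.
  move=> aP; rewrite real_leNgt ?(gtr0_real d0C) //; apply/negP => xa; apply: hw.
  exists a => //; rewrite wP aP andbT.
  rewrite -[a](subrK x); apply: le_lt_trans (ler_normD _ _) _.
  by rewrite -(subrK delta b) rmorphD /= [ltRHS]addrC ltrD // distrC.
have := hn x (ltW xr); rewrite hphi (rootP rx) !mulr0 sub0r normrN.
move=> /(le_trans (low x (ltW xr) hx)).
by rewrite ler_pdivlMr // ger_pMr // lt_geF // ltr1n.
Qed.
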